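(* Any CONGEST algorithm (possibly randomized, succeeding with probability at least $2/3$) that, given a directed unweighted $n$-vertex graph of undirected diameter $D$ and two vertices $s,t$, decides whether $t$ is reachable from $s$, or computes the $s$-$t$ shortest path distance, requires $\Omega\!\left(\frac{\sqrt{n}}{\log n}+D\right)$ rounds in the worst case.
   Context: CONGEST model: the communication network is the graph $G=(V,E)$, $n=|V|$; each node has a unique identifier in $\{0,\dots,n-1\}$, knows its own and its neighbours' identifiers and its incident edges (with their directions); computation proceeds in synchronous rounds in which each node may send a message of $O(\log n)$ bits to each neighbour; local computation is free; communication links are bidirectional even when $G$ is directed. The undirected diameter $D$ is the diameter of the underlying undirected unweighted graph of $G$.
   Formalization: The bound is proved for undirected diameters D with c·log n ≤ D ≤ n−1 for some constant c, not for smaller D; for D = 1 the claim as stated fails, since reachability is then decidable in O(1) rounds. *)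

(* Defs.v *)
From mathcomp Require Import all_boot.
Set Implicit Arguments. Unset Strict Implicit. Unset Printing Implicit Defensive.

Section Graphs.
Variable n : nat.
Implicit Types (r : rel 'I_n) (u v : 'I_n).

Fixpoint ball r k u : {set 'I_n} :=
  if k is k'.+1 then
    ball r k' u :|: [set w | [exists x in ball r k' u, r x w]]
  else [set u].

Definition within r k u v : bool := v \in ball r k u.

Definition uadj (e : rel 'I_n) : rel 'I_n :=
  fun u v => (u != v) && (e u v || e v u).

Definition loopless (e : rel 'I_n) : Prop := forall v, ~~ e v v.

Definition udiam_eq (e : rel 'I_n) (D : nat) : Prop :=
  (forall u v, within (uadj e) D u v) /\
  (exists u v, forall k, k < D -> ~~ within (uadj e) k u v).

Definition reachable (e : rel 'I_n) s t : bool := connect e s t.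

(* directed s-t distance: Some k with k the least number of arcs of a
   directed s-t path, None (= infinity) if t is unreachable from s.
   (Shortest paths have at most n-1 arcs.) *)
Definition ddist (e : rel 'I_n) s t : option nat :=
  let k := find (fun k => within e k s t) (iota 0 n) in
  if k < n then Some k else None.
End Graphs.

Record local_input (n : nat) := LocalInput {
  li_id  : 'I_n;
  li_out : {set 'I_n};
  li_in  : {set 'I_n};
  li_s   : bool;
  li_t   : bool }.

Definition input_of n (e : rel 'I_n) (s t v : 'I_n) : local_input n :=
  LocalInput v [set w | e v w] [set w | e w v] (v == s) (v == t).

Definition msg (B : nat) := option (B.-tuple bool).

(* A (randomized) CONGEST algorithm for n-node networks, bandwidth B bits
   per edge per round, each node having m private random bits; local
   computation is arbitrary (unrestricted state type and functions). *)
Record congest_algo (n B m : nat) (Out : Type) := CongestAlgo {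
  St   : Type;
  init : local_input n -> {ffun 'I_m -> bool} -> St;
  (* send k x w : message sent in round k, in state x, to neighbour w *)
  send : nat -> St -> 'I_n -> msg B;
  (* recv k x M : new state after round k given received messages M w
     from each neighbour w (None from non-neighbours) *)
  recv : nat -> St -> ('I_n -> msg B) -> St;
  output : St -> Out }.

Section Exec.
Variables (n B m : nat) (Out : Type) (A : congest_algo n B m Out).
Variables (e : rel 'I_n) (s t : 'I_n) (omega : {ffun 'I_n -> {ffun 'I_m -> bool}}).

Fixpoint state (k : nat) : 'I_n -> St A :=
  if k is k'.+1 then
    fun v => @recv _ _ _ _ A k' (state k' v)
               (fun w => if uadj e w v then @send _ _ _ _ A k' (state k' w) v else None)
  else fun v => @init _ _ _ _ A (input_of e s t v) (omega v).
End Exec.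

(* Running A for T rounds on (e, s, t), the output of the target t equals
   ans with probability at least 2/3 over the nodes' uniform random bits. *)
Definition succeeds_whp n B m (Out : eqType) (A : congest_algo n B m Out) (T : nat)
    (e : rel 'I_n) (s t : 'I_n) (ans : Out) : Prop :=
  3 * #|[set omega : {ffun 'I_n -> {ffun 'I_m -> bool}} |
          @output _ _ _ _ A (state A e s t omega T t) == ans]|
  >= 2 * #|{ffun 'I_n -> {ffun 'I_m -> bool}}|.

(* Lower bound Omega(sqrt n / log n + D) on the worst-case number of rounds
   for a problem with answer function ans, in the CONGEST model with
   O(log n)-bit messages (b * ceil(log2 n) bits, for any constant b).
   The conclusion "T >= (sqrt n / log n + D) / K'" is expressed, up to a
   constant factor, as  K*T >= D  and  n <= (K * T * floor(log2 n))^2. *)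
Definition round_lower_bound (Out : eqType)
    (ans : forall n, rel 'I_n -> 'I_n -> 'I_n -> Out) : Prop :=
  forall b : nat, 0 < b ->
  exists K N c0 : nat, 0 < K /\
  forall n, N <= n ->
  forall D, c0 * up_log 2 n <= D <= n.-1 ->
  forall (m T : nat) (A : congest_algo n (b * up_log 2 n) m Out),
    (forall (e : rel 'I_n) (s t : 'I_n),
        loopless e -> udiam_eq e D -> succeeds_whp A T e s t (ans n e s t)) ->
    D <= K * T /\ n <= (K * T * trunc_log 2 n) ^ 2.

(* Main.v *)
Require Import Defs.
From mathcomp Require Import all_boot all_order all_algebra zify ring.
From Stdlib Require Import FunctionalExtensionality.
Set Implicit Arguments. Unset Strict Implicit. Unset Printing Implicit Defensive.

(** Alice's and Bob's vectors [x] and [y] are encoded in the orientations at the two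
    ends of a bundle of O(k) wires of length about 2T, so that [t] is reachable from
    [s] iff the inner product of [x] and [y] modulo 2 is 1.  The underlying undirected
    graph is fixed: a Fenwick tree over the columns gives all wires a common
    logarithmic eccentricity, and a pendant path of length D makes the diameter
    exactly D.  In T rounds Alice and Bob only influence each other through the tree
    edges, i.e. through O(T log n) messages of O(log n) bits, so that for each choice
    of the random bits the input pairs with the same messages form a combinatorial
    rectangle on which the output depends on [y] alone.  By Lindsey's lemma such a
    rectangle has small discrepancy for the inner product, hence k = O(T log^2 n); as
    k can be chosen as large as n / T allows, n = O(T^2 log^2 n).  The bound in D
    follows by reversing the first arc of a path of length D. *)

(** * Distances in a relation and the undirected diameter *)

Section Within.
Variables (n : nat) (r : rel 'I_n).
Implicit Types (u v w : 'I_n).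

Lemma within0 u : within r 0 u u.
Proof. by rewrite /within /= inE. Qed.

Lemma withinSE k u w :
  within r k.+1 u w = within r k u w || [exists v, within r k u v && r v w].
Proof. by rewrite /within /= !inE. Qed.

Lemma withinS k u v w : within r k u v -> r v w -> within r k.+1 u w.
Proof.
by move=> uv vw; rewrite withinSE; apply/orP; right; apply/existsP; exists v; rewrite uv.
Qed.

Lemma within1 u v : r u v -> within r 1 u v.
Proof. exact: withinS (within0 u). Qed.

Lemma within_mono k l u v : k <= l -> within r k u v -> within r l u v.
Proof.
move/subnK <-; elim: (l - k) => // j IHj uv.
by rewrite addSn withinSE IHj.
Qed.

Lemma within_trans k l u v w :
  within r k u v -> within r l v w -> within r (k + l) u w.
Proof.
move=> uv; elim: l w => [|l IHl] w; first by rewrite addn0 /within inE => /eqP ->.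
rewrite addnS withinSE => /orP[/IHl|/existsP[x /andP[/IHl ux xw]]].
  exact: within_mono.
exact: withinS ux xw.
Qed.

Lemma within_sym k u v : symmetric r -> within r k u v -> within r k v u.
Proof.
move=> rC; elim: k v => [|k IHk] v; first by rewrite /within !inE eq_sym.
rewrite withinSE => /orP[/IHk|/existsP[x /andP[/IHk ux xv]]].
  exact: within_mono.
by rewrite -add1n; apply: within_trans ux; apply: within1; rewrite rC.
Qed.

Lemma within_lipschitz (f : 'I_n -> nat) k u v :
  (forall u v, r u v -> f v <= (f u).+1) -> within r k u v -> f v <= f u + k.
Proof.
move=> fr; elim: k v => [|k IHk] v; first by rewrite /within inE addn0 => /eqP ->.
rewrite withinSE => /orP[/IHk|/existsP[x /andP[/IHk ux /fr xv]]]; lia.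
Qed.

Lemma within_connect k u v : within r k u v -> connect r u v.
Proof.
elim: k v => [|k IHk] v; first by rewrite /within inE => /eqP ->.
rewrite withinSE => /orP[/IHk //|/existsP[x /andP[/IHk ux xv]]].
exact: connect_trans ux (connect1 xv).
Qed.

Lemma path_within u p : path r u p -> within r (size p) u (last u p).
Proof.
elim/last_ind: p => [|p w IHp]; first by rewrite within0.
by rewrite rcons_path size_rcons last_rcons => /andP[/IHp]; apply: withinS.
Qed.

Lemma connect_within u v : connect r u v -> exists2 k, k < n & within r k u v.
Proof.
case/connectP=> p rp ->; case/shortenP: rp => p' rp' up' _.
exists (size p'); last exact: path_within.
by have := max_card (mem (u :: p')); rewrite (card_uniqP up') card_ord.
Qed.

(** Makes the distance problem at least as hard as reachability. *)
Lemma ddist_reachable u v : (ddist r u v != None) = reachable r u v.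
Proof.
rewrite /ddist; case: ifPn => [fn|fn].
  apply/esym; rewrite /reachable.
  have := fn; rewrite -[X in _ < X](size_iota 0 n) -has_find => /hasP[k _].
  exact: within_connect.
apply/esym/negbTE/negP => /connect_within[k kn ruv]; case/negP: fn.
rewrite -[X in _ < X](size_iota 0 n) -has_find; apply/hasP.
by exists k => //; rewrite mem_iota.
Qed.

End Within.

Lemma uadjC n (e : rel 'I_n) : symmetric (uadj e).
Proof. by move=> u v; rewrite /uadj eq_sym orbC. Qed.

(* Two adjacent centres are needed when D is odd. *)
Lemma udiam_eqI n (e : rel 'I_n) D (f : 'I_n -> nat) (c c' u0 v0 : 'I_n) :
  within (uadj e) (odd D) c c' ->
  (forall v, within (uadj e) D./2 c v \/ within (uadj e) D./2 c' v) ->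
  (forall u v, uadj e u v -> f v <= (f u).+1) ->
  f u0 = 0 -> f v0 = D -> udiam_eq e D.
Proof.
set r := uadj e => cc' cov flip f0 fD; have rC : symmetric r by apply: uadjC.
have DE := odd_double_half D.
split=> [u v|]; last first.
  exists u0, v0 => k kD; apply/negP => /(within_lipschitz flip); lia.
have [uc|uc] := cov u; have [vc|vc] := cov v.
- apply: within_mono (within_trans (within_sym rC uc) vc); lia.
- apply: within_mono (within_trans (within_trans (within_sym rC uc) cc') vc); lia.
- apply: within_mono (within_trans (within_trans (within_sym rC uc)
    (within_sym rC cc')) vc); lia.
- apply: within_mono (within_trans (within_sym rC uc) vc); lia.
Qed.

(** * Cut and paste of runs with equal transcripts *)

Definition rectangular (X Y Tr Out : Type) (tau : X -> Y -> Tr) (out : X -> Y -> Out) :=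
  forall x x' y y', tau x y = tau x' y' -> tau x y' = tau x y /\ out x y' = out x' y'.

Section CutAndPaste.
Variables (n B m h T : nat) (Out : Type) (A : congest_algo n B m Out).
Variables (X Y : Type) (e : X -> Y -> rel 'I_n) (s t : 'I_n).
Variables (adj : rel 'I_n) (pos : 'I_n -> nat) (cross : nat -> 'I_h -> 'I_n * 'I_n).
Variable omega : {ffun 'I_n -> {ffun 'I_m -> bool}}.

Let st x y := state A (e x y) s t omega.
Let message x y k u v := @send _ _ _ _ A k (st x y k u) v.

(* After k rounds Alice knows the nodes at positions at most 2T - k and Bob those
   at positions greater than k; the transcript records the messages that reach the
   nodes one of them must know next from nodes outside that player's zone. *)
Definition transcript x y : {ffun 'I_T * bool * 'I_h -> msg B} :=
  [ffun q => let k := val q.1.1 in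
     if q.1.2 then let vw := cross (T.*2 - k) q.2 in message x y k vw.2 vw.1
     else let vw := cross k.+1 q.2 in message x y k vw.1 vw.2].

Hypothesis adjE : forall x y, uadj (e x y) =2 adj.
Hypothesis left_input : forall x x' y v,
  0 < pos v -> input_of (e x y) s t v = input_of (e x' y) s t v.
Hypothesis right_input : forall x y y' v,
  pos v <= T.*2 -> input_of (e x y) s t v = input_of (e x y') s t v.
Hypothesis crossP : forall c v w,
  adj v w -> pos v < c < pos w -> exists a, cross c a = (v, w).
Hypothesis post : T < pos t.

(** A neighbour outside a player's previous zone is reached by an edge passing over column [2T - k],
    resp. [k.+1], so [crossP] finds its message in the common transcript. As [k <= T], the two zones
    cover the graph, so by induction that neighbour sends the same message in the mixed run on
    [(x, y')]. *)
Lemma paste_state x x' y y' k : transcript x y = transcript x' y' -> k <= T ->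
  (forall v, pos v + k <= T.*2 -> st x y' k v = st x y k v) /\
  (forall v, k < pos v -> st x y' k v = st x' y' k v).
Proof.
move=> tauE; elim: k => [_|k IHk kT].
  split=> v pv; rewrite /st /=; first by rewrite (right_input x y' y) // -(addn0 (pos v)).
  by rewrite (left_input x x').
have {IHk} [IHA IHB] := IHk (ltnW kT).
have adjC : symmetric adj by move=> u v; rewrite -!(adjE x y) uadjC.
have msgA v w a : cross (T.*2 - k) a = (v, w) -> message x y k w v = message x' y' k w v.
  by move=> cr; have /ffunP/(_ (Ordinal kT, true, a)) := tauE; rewrite !ffunE /= cr.
have msgB v w a : cross k.+1 a = (v, w) -> message x y k v w = message x' y' k v w.
  by move=> cr; have /ffunP/(_ (Ordinal kT, false, a)) := tauE; rewrite !ffunE /= cr.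
split=> v pv; rewrite /st /= -!/(st _ _ _ _).
  have vk : pos v + k <= T.*2 by lia.
  rewrite (IHA v vk); congr recv; apply: functional_extensionality => w.
  rewrite !adjE; case: ifP => // wv.
  have [wk|wk] := leqP (pos w + k) T.*2; first by rewrite -!/(st _ _ _ _) IHA.
  have [||a cr] := @crossP (T.*2 - k) v w; [by rewrite adjC|lia|].
  by rewrite -!/(message _ _ _ _ _) (msgA _ _ _ cr) /message IHB //; lia.
rewrite (IHB v (ltnW pv)); congr recv; apply: functional_extensionality => w.
rewrite !adjE; case: ifP => // wv.
have [wk|wk] := ltnP k (pos w); first by rewrite -!/(st _ _ _ _) IHB.
have [||a cr] := @crossP k.+1 w v; [by []|lia|].
by rewrite -!/(message _ _ _ _ _) -(msgB _ _ _ cr) /message IHA //; lia.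
Qed.

(** Every sender lies in one of the two zones, so its message in the mixed run is that of [(x, y)]
    or of [(x', y')], which the transcripts equate. The output follows Bob's input because [post]
    keeps [t] in his zone through round [T]. *)
Lemma transcript_rectangular (dec : Out -> bool) :
  rectangular transcript (fun x y => dec (@output _ _ _ _ A (st x y T t))).
Proof.
move=> x x' y y' tauE; split; last first.
  by rewrite (proj2 (paste_state tauE (leqnn T))).
apply/ffunP=> -[[k b] a]; have kT := ltn_ord k; rewrite !ffunE /= /message.
have [stA stB] := paste_state tauE (ltnW kT).
have /ffunP/(_ (k, b, a)) := tauE; rewrite !ffunE /= /message.
case: b => /=; case: (cross _ a) => v w /= msgE.
- have [wk|wk] := leqP (pos w + k) T.*2; first by rewrite stA.
  by rewrite stB ?msgE //; lia.
- have [vk|vk] := ltnP k (pos v); first by rewrite stB ?msgE.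
  by rewrite stA //; lia.
Qed.

End CutAndPaste.

(** * Discrepancy of rectangles under an orthogonal sign matrix *)

Section Discrepancy.
Import GRing.Theory Num.Theory Order.TTheory.
Local Open Scope ring_scope.
Variables (X Y : finType) (c : nat) (f : X -> Y -> bool).
Hypotheses (c_gt0 : (0 < c)%N) (cardX : #|X| = (c ^ 2)%N) (cardY : #|Y| = (c ^ 2)%N).

Let chi x y : int := (-1) ^+ f x y.
Hypothesis orth : forall y y', y != y' -> \sum_x chi x y * chi x y' = 0.

Let orthE y y' : \sum_x chi x y * chi x y' = (y == y')%:R * c%:R ^+ 2.
Proof.
have [->|/orth ->] := eqVneq y y'; last by rewrite mul0r.
rewrite mul1r (eq_bigr (fun=> 1)) => [|x _]; last by rewrite -expr2 sqrr_sign.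
by rewrite sumr_const cardX natrX.
Qed.

(* Lindsey's lemma; AM-GM [2 c a <= a^2 + c^2] replaces Cauchy-Schwarz. *)
Lemma rectangle_discrepancy (P : pred X) (Q : pred Y) (g : Y -> bool) :
  \sum_(x | P x) \sum_(y | Q y) (-1) ^+ g y * chi x y <= c%:R ^+ 3.
Proof.
pose a x := \sum_(y | Q y) (-1) ^+ g y * chi x y.
have c0 : 0 < c%:R :> int by rewrite ltr0n.
(* Parseval: orthogonality removes the off-diagonal terms of the expanded squares. *)
have sqsum : \sum_x a x ^+ 2 = #|Q|%:R * c%:R ^+ 2.
  transitivity (\sum_(y | Q y) \sum_(y' | Q y')
      (-1) ^+ g y * (-1) ^+ g y' * \sum_x chi x y * chi x y').
    under eq_bigr => x _ do rewrite expr2 /a mulr_suml.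
    rewrite exchange_big; apply: eq_bigr => y _.
    under eq_bigr => x _ do rewrite mulr_sumr.
    rewrite exchange_big; apply: eq_bigr => y' _; rewrite mulr_sumr.
    by apply: eq_bigr => x _; ring.
  rewrite -sumr_const mulr_suml; apply: eq_bigr => y Qy.
  rewrite (bigD1 y) //= orthE eqxx big1 => [|y' /andP[_ y'y]].
    by rewrite -expr2 sqrr_sign addr0 !mul1r.
  by rewrite orthE eq_sym (negbTE y'y) mul0r mulr0.
have QY : #|Q|%:R <= c%:R ^+ 2 :> int by rewrite -natrX ler_nat -cardY max_card.
have : \sum_(x | P x) (c%:R *+ 2) * a x <= \sum_x (a x ^+ 2 + c%:R ^+ 2).
  rewrite big_mkcond; apply: ler_sum => x _; case: ifP => _.
    by have := sqr_ge0 (a x - c%:R); rewrite -[_ *+ 2]mulr_natr; nia.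
  by rewrite addr_ge0 ?sqr_ge0.
rewrite -mulr_sumr big_split sumr_const cardX sqsum -[_ *+ (c ^ 2)]mulr_natr natrX /= => le.
(* With [S] the sum over [P], [2cS <= #|Q| c^2 + c^4 <= 2c^4]. *)
rewrite -(ler_pM2l c0); have : 0 <= c%:R ^+ 2 :> int by rewrite sqr_ge0.
move: le QY; rewrite -[_ *+ 2]mulr_natr; set q := #|Q|%:R; set S := \sum_(i | _) _; nia.
Qed.

Lemma rectangular_discrepancy (Tr : finType) (tau : X -> Y -> Tr) (out : X -> Y -> bool) :
  rectangular tau out ->
  \sum_x \sum_y (-1) ^+ out x y * chi x y <= #|Tr|%:R * c%:R ^+ 3.
Proof.
move=> rect; pose P tr x := [exists y, tau x y == tr].
pose Q tr y := [exists x, tau x y == tr].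
(* Any row of the fibre serves to read the output, by [rectangular]; the default [false] never
   occurs on the fibre itself. *)
pose g tr y := if [pick x | tau x y == tr] is Some x then out x y else false.
have tauE tr x y : (tau x y == tr) = P tr x && Q tr y.
  apply/idP/andP => [xy|[/existsP[y' /eqP xy'] /existsP[x' /eqP x'y]]].
    by split; apply/existsP; [exists y|exists x].
  by have [|-> _] := rect x x' y' y; rewrite ?xy' ?x'y.
rewrite pair_big (partition_big (fun p => tau p.1 p.2) xpredT) //=.
rewrite mulr_natl -sumr_const; apply: ler_sum => tr _.
apply: le_trans (rectangle_discrepancy (P tr) (Q tr) (g tr)).
rewrite pair_big le_eqVlt; apply/orP; left; apply/eqP/eq_big => [p|p /eqP taup].
  exact: tauE.
congr (_ * _); rewrite /g; case: pickP => [x' /eqP tau'|/(_ p.1)]; last first.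
  by rewrite taup eqxx.
by case: (rect x' p.1 p.2 p.2); rewrite ?taup ?tau' // => _ ->.
Qed.

(** Averaged over the coins, success correlates the output with [f] by at least 2/3 - 1/3 at each of
    the [c ^ 4] input pairs, while for fixed coins the total correlation is at most
    [#|Tr| * c ^ 3]. *)
Lemma two_thirds_success_bound (Om Tr : finType) (tau : Om -> X -> Y -> Tr)
    (out : Om -> X -> Y -> bool) :
  (0 < #|Om|)%N -> (forall w, rectangular (tau w) (out w)) ->
  (forall x y, 2 * #|Om| <= 3 * #|[set w | out w x y == f x y]|)%N ->
  (c <= 3 * #|Tr|)%N.
Proof.
move=> Om0 rect succ.
have up : \sum_w \sum_x \sum_y (-1) ^+ out w x y * chi x y
    <= #|Om|%:R * (#|Tr|%:R * c%:R ^+ 3).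
  rewrite mulr_natl -sumr_const; apply: ler_sum => w _.
  exact: rectangular_discrepancy (rect w).
have low x y : #|Om|%:R <= 3 * \sum_w (-1) ^+ out w x y * chi x y.
  pose G := [set w | out w x y == f x y].
  have -> : \sum_w (-1) ^+ out w x y * chi x y = #|G|%:R - #|~: G|%:R.
    rewrite (bigID (mem G)) -!sumr_const -sumrN /=; congr (_ + _).
      apply: eq_bigr => w; rewrite inE => /eqP ->.
      by rewrite /chi -expr2 sqrr_sign.
    apply: eq_big => [w|w]; first by rewrite !inE.
    by rewrite inE /chi; case: (out w x y); case: (f x y).
  have := cardsC G; have := succ x y; rewrite -/G; lia.
have {low} : \sum_(x : X) \sum_(y : Y) #|Om|%:R <=
    3 * \sum_w \sum_x \sum_y (-1) ^+ out w x y * chi x y.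
  rewrite [X in 3 * X]exchange_big mulr_sumr; apply: ler_sum => x _.
  rewrite [X in 3 * X]exchange_big mulr_sumr; apply: ler_sum => y _.
  exact: low.
rewrite !sumr_const cardX cardY -mulrnA -expnD -[_ *+ (c ^ _)]mulr_natr natrX => low.
have {low up} : #|Om|%:R * c%:R ^+ 4 <= 3 * (#|Om|%:R * (#|Tr|%:R * c%:R ^+ 3)) :> int.
  exact: le_trans low (ler_wpM2l _ up).
rewrite -!natrX -!natrM ler_nat.
have -> : (3 * (#|Om| * (#|Tr| * c ^ 3)) = #|Om| * c ^ 3 * (3 * #|Tr|))%N by ring.
by rewrite expnSr mulnA leq_pmul2l // muln_gt0 Om0 expn_gt0 c_gt0.
Qed.

End Discrepancy.

(** * Inner product modulo 2 *)

Section InnerProduct.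
Variable k : nat.
Implicit Types x y : {ffun 'I_k -> bool}.

(** The walk through the gadget carries this partial inner product as its state. *)
Definition inner_prefix x y i : bool := \big[addb/false]_(j < k | j < i) (x j && y j).

Lemma inner_prefix0 x y : inner_prefix x y 0 = false.
Proof. by rewrite /inner_prefix big_pred0. Qed.

Lemma inner_prefixS x y (i : 'I_k) :
  inner_prefix x y i.+1 = inner_prefix x y i (+) (x i && y i).
Proof.
rewrite /inner_prefix (bigD1 i) //= addbC; congr (_ (+) _); apply: eq_bigl => j.
by rewrite ltnS [in RHS]ltn_neqAle andbC.
Qed.

Import GRing.Theory Num.Theory.
Local Open Scope ring_scope.

Lemma inner_prefix_sign x y :
  (-1) ^+ inner_prefix x y k = \prod_(i < k) (-1) ^+ (x i && y i) :> int.
Proof.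
rewrite /inner_prefix (eq_bigl xpredT) => [|i]; last by rewrite ltn_ord.
by apply: (big_morph (fun b : bool => (-1) ^+ b)) => // a b; rewrite signr_addb.
Qed.

(** The sum factors over the coordinates, and one where [y] and [y'] differ contributes the factor
    [1 - 1]. *)
Lemma inner_product_orthogonal y y' : y != y' ->
  \sum_x (-1) ^+ inner_prefix x y k * (-1) ^+ inner_prefix x y' k = 0 :> int.
Proof.
move=> yy'; have [i yi] : exists i, y i != y' i.
  apply/existsP; apply: contraR yy'; rewrite negb_exists => /forallP eqy.
  by apply/eqP/ffunP => i; apply/eqP; have := eqy i; rewrite negbK.
transitivity (\sum_(x : {ffun 'I_k -> bool})
    \prod_(i < k) ((-1) ^+ (x i && y i) * (-1) ^+ (x i && y' i)) : int).
  by apply: eq_bigr => x _; rewrite !inner_prefix_sign -big_split.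
rewrite -(bigA_distr_bigA (fun i b => (-1) ^+ (b && y i) * (-1) ^+ (b && y' i))).
rewrite (bigD1 i) //= big_bool; move: yi.
by case: (y i); case: (y' i) => //= _; rewrite mul0r.
Qed.

End InnerProduct.

(** * The gadget graph *)

Section FlippedOrientation.
Variables (V : eqType) (base ok : rel V).

(** Arcs are reversed rather than deleted, so that the links and the diameter do not depend on the
    inputs. *)
Definition oriented : rel V :=
  fun u v => base u v && ok u v || base v u && ~~ ok v u.

Lemma oriented_sym u v : oriented u v || oriented v u = base u v || base v u.
Proof.
by rewrite /oriented; case: (base u v); case: (base v u); case: (ok u v); case: (ok v u).
Qed.

End FlippedOrientation.

Section Gadget.
Variables k T h D r : nat.
Implicit Types x y : {ffun 'I_k -> bool}.

(* The wire [inl (i, p, b, q)] leads from left to right, from the state [(i, p)] to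
   the state [(i.+1, q)]; Alice enables it if [b = x i], and Bob if
   [q = p (+) (b && y i)].  The wire [inr (i, p)] of the state [(i, p)] leads from
   right to left. *)
Definition wire : Type := 'I_k * bool * bool * bool + 'I_k.+1 * bool.

(** Each wire has one node in each column from [0] to [2T + 1], and each column has a hub. The spine
    is the path of length [D]; the [r] pads bring the node count to [n]. *)
Definition node : Type := (wire * 'I_T.*2.+2 + 'I_T.*2.+2) + ('I_D.+1 + 'I_r).

Notation Wire w c := (inl (inl (w, c))).
Notation Hub c := (inl (inr c)).
Notation Spine i := (inr (inl i)).
Notation Pad j := (inr (inr j)).

(* A Fenwick tree: the parent of [j] is [j] with its lowest binary digit cleared. *)
Definition hub_edge (i j : nat) :=
  [exists a : 'I_h, (2 ^ a.+1 %| i) && (j == i + 2 ^ a)].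

(** Arcs between hubs and wires point into the wires, so the tree and the spine shorten undirected
    distances without letting a directed walk leave the wires. *)
Definition base (u v : node) : bool :=
  match u, v with
  | Wire (inr (i, p)) c, Wire (inl (i', p', _, _)) c' =>
      [&& i' == i :> nat, p' == p, c == 0 :> nat & c' == 0 :> nat]
  | Wire (inl (i, _, _, q)) c, Wire (inr (i', p')) c' =>
      [&& i' == i.+1 :> nat, p' == q, c == T.*2.+1 :> nat & c' == T.*2.+1 :> nat]
  | Wire (inl f) c, Wire (inl f') c' => (f == f') && (c' == c.+1 :> nat)
  | Wire (inr f) c, Wire (inr f') c' => (f == f') && (c == c'.+1 :> nat)
  | Hub c, Wire _ c' => c == c' :> nat
  | Hub i, Hub j => hub_edge i j
  | Spine i, Spine j => j == i.+1 :> nat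
  | Spine i, Hub c => (i == D./2 :> nat) && (c == 0 :> nat)
  | Spine i, Pad _ => i == D./2 :> nat
  | _, _ => false
  end.

Definition enabled x y (u v : node) : bool :=
  match u, v with
  | Wire (inr _) _, Wire (inl (i, _, b, _)) _ => b == x i
  | Wire (inl (i, p, b, q)) _, Wire (inr _) _ => q == p (+) (b && y i)
  | _, _ => true
  end.

Definition pos (u : node) : nat :=
  match u with Wire _ c => c | Hub c => c | _ => 0 end.

(** For each [a], at most one tree edge of length [2 ^ a] passes over [c]: it starts at [c] rounded
    down to a multiple of [2 ^ a.+1]. So [h] messages per column suffice. *)
Definition hub_cross (c : nat) (a : 'I_h) : node * node :=
  let i := c %/ 2 ^ a.+1 * 2 ^ a.+1 in (Hub (inord i), Hub (inord (i + 2 ^ a))).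

Definition spine_rank (u : node) : nat :=
  match u with Spine i => i | _ => D./2 end.

Lemma base_irrefl u : base u u = false.
Proof.
case: u => [[[[[[[i p] b] q]|[i p]] c]|c]|[i|j]] //=; try lia.
by apply/negbTE/existsP => -[a]; have := expn_gt0 2 a; lia.
Qed.

Lemma enabled_left x x' y u v : base u v -> (0 < pos u) || (0 < pos v) ->
  enabled x y u v = enabled x' y u v.
Proof.
case: u => [[[[[[[i p] b] q]|[i p]] c]|c]|[i|j]] //=;
case: v => [[[[[[[i' p'] b'] q']|[i' p']] c']|c']|[i'|j']] //=.
by case/and4P=> _ _ /eqP -> /eqP ->.
Qed.

Lemma enabled_right x y y' u v : base u v -> (pos u <= T.*2) || (pos v <= T.*2) ->
  enabled x y u v = enabled x y' u v.
Proof.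
case: u => [[[[[[[i p] b] q]|[i p]] c]|c]|[i|j]] //=;
case: v => [[[[[[[i' p'] b'] q']|[i' p']] c']|c']|[i'|j']] //=.
by case/and4P=> _ _ /eqP -> /eqP ->; rewrite ltnn.
Qed.

Lemma base_long u v c : base u v || base v u -> pos u < c < pos v ->
  exists a, hub_cross c a = (u, v).
Proof.
case: u => [[[[[[[i p] b] q]|[i p]] c1]|c1]|[i|j]] //=;
case: v => [[[[[[[i' p'] b'] q']|[i' p']] c2]|c2]|[i'|j']] //=; try lia.
case/orP => /existsP[a /andP[div /eqP jE]] lt; last by lia.
exists a; rewrite /hub_cross.
have -> : c %/ 2 ^ a.+1 * 2 ^ a.+1 = c1.
  case/dvdnP: div => m mE; rewrite mE; congr (_ * _).
  have lt2 : c - m * 2 ^ a.+1 < 2 ^ a.+1 by rewrite [X in _ < X]expnS; lia.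
  have -> : c = m * 2 ^ a.+1 + (c - m * 2 ^ a.+1) by lia.
  by rewrite divnMDl ?expn_gt0 // divn_small // addn0.
by rewrite -jE !inord_val.
Qed.

Lemma spine_rank_lipschitz u v : base u v || base v u -> spine_rank v <= (spine_rank u).+1.
Proof.
case: u => [[[[[[[i p] b] q]|[i p]] c1]|c1]|[i|j]] //=;
case: v => [[[[[[[i' p'] b'] q']|[i' p']] c2]|c2]|[i'|j']] //=; lia.
Qed.

(** * Diameter and reachability in the embedded gadget *)

Section Embedding.
Variables (n : nat) (dec : 'I_n -> node) (enc : node -> 'I_n).
Hypotheses (decK : cancel dec enc) (encK : cancel enc dec).

Definition gadget x y : rel 'I_n := relpre dec (oriented base (enabled x y)).

Definition gadget_adj : rel 'I_n := relpre dec (fun u v => base u v || base v u).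

Lemma uadj_gadget x y : uadj (gadget x y) =2 gadget_adj.
Proof.
move=> u v; rewrite /uadj /gadget /gadget_adj /= oriented_sym.
by case: eqVneq => // ->; rewrite base_irrefl.
Qed.

Lemma gadget_loopless x y : loopless (gadget x y).
Proof. by move=> v; rewrite /gadget /oriented /= base_irrefl. Qed.

Let input_eq x y x' y' s t v :
  (forall u, gadget x y v u = gadget x' y' v u) ->
  (forall u, gadget x y u v = gadget x' y' u v) ->
  input_of (gadget x y) s t v = input_of (gadget x' y') s t v.
Proof.
by move=> eqo eqi; congr LocalInput; apply/setP => u; rewrite !inE.
Qed.

Lemma gadget_left_input x x' y s t v : 0 < pos (dec v) ->
  input_of (gadget x y) s t v = input_of (gadget x' y) s t v.
Proof.
move=> pv; apply: input_eq => u; rewrite /gadget /oriented /=;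
by congr (_ || _); case bE: (base _ _) => //=; rewrite (enabled_left x x') ?pv ?orbT.
Qed.

Lemma gadget_right_input x y y' s t v : pos (dec v) <= T.*2 ->
  input_of (gadget x y) s t v = input_of (gadget x y') s t v.
Proof.
move=> pv; apply: input_eq => u; rewrite /gadget /oriented /=;
by congr (_ || _); case bE: (base _ _) => //=; rewrite (enabled_right x y y') ?pv ?orbT.
Qed.

Definition gadget_cross c a := (enc (hub_cross c a).1, enc (hub_cross c a).2).

Lemma gadget_crossP c v w : gadget_adj v w -> pos (dec v) < c < pos (dec w) ->
  exists a, gadget_cross c a = (v, w).
Proof.
move=> adj lt; have [a aE] := base_long adj lt.
by exists a; rewrite /gadget_cross aE /= !decK.
Qed.

Let near j u v := within gadget_adj j (enc u) (enc v).

Let near1 u v : base u v -> near 1 u v.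
Proof. by move=> uv; apply: within1; rewrite /gadget_adj /= !encK uv. Qed.

Let nearC j u v : near j u v -> near j v u.
Proof. by apply: within_sym => a b; rewrite /gadget_adj /= orbC. Qed.

Let near_spine (i j : 'I_D.+1) : i <= j -> near (j - i) (Spine i) (Spine j).
Proof.
move=> ij; move: (subnK ij); move: (j - i) => d; elim: d j {ij} => [|d IHd] j jE.
  have -> : j = i by apply/val_inj/esym.
  exact: within0.
have dD : d + i < D.+1 by have := ltn_ord j; lia.
rewrite -addn1; apply: within_trans (IHd (Ordinal dD) erefl) _.
by apply: near1; rewrite /= -jE.
Qed.

Hypothesis Th : T.*2.+2 <= 2 ^ h.

(** A multiple of [2 ^ (h - a)] below [2 ^ h] has at most [a] nonzero binary digits, and each step
    to the parent clears one. *)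
Let near_hub a (j : 'I_T.*2.+2) : a <= h -> 2 ^ (h - a) %| j -> near a (Hub ord0) (Hub j).
Proof.
elim: a j => [|a IHa] j ah.
  rewrite subn0 => /dvdnP[m mE]; have jT := ltn_ord j.
  have -> : j = ord0; last exact: within0.
  by apply: val_inj => /=; case: m mE => [|m] //; nia.
set d := h - a.+1 => div; have dE : h - a = d.+1 by lia.
have [div2|ndiv2] := boolP (2 ^ d.+1 %| j).
  by apply: within_mono (IHa _ (ltnW ah) _) => //; rewrite dE.
case/dvdnP: div => m mE.
have oddm : odd m.
  apply: contraR ndiv2 => evm; rewrite mE expnS dvdn_pmul2r ?expn_gt0 //.
  by rewrite dvdn2.
have jE : j = m./2 * 2 ^ d.+1 + 2 ^ d :> nat.
  by rewrite mE -{1}(odd_double_half m) oddm expnS; lia.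
have iT : m./2 * 2 ^ d.+1 < T.*2.+2 by have := ltn_ord j; lia.
rewrite -addn1; apply: within_trans (IHa (Ordinal iT) (ltnW ah) _) _.
  by rewrite dE dvdn_mull.
have dh : d < h by lia.
by apply: near1; apply/existsP; exists (Ordinal dh); rewrite /= dvdn_mull //= jE.
Qed.

Hypothesis hD : h + 2 <= D./2.

Let mid_lt : D./2 < D.+1. Proof. lia. Qed.
Let umid_lt : uphalf D < D.+1. Proof. lia. Qed.

Lemma gadget_udiam x y : udiam_eq (gadget x y) D.
Proof.
have adjE : uadj (gadget x y) =2 gadget_adj by apply: uadj_gadget.
have winE j u v : within (uadj (gadget x y)) j u v = within gadget_adj j u v.
  elim: j v => // j IHj v; rewrite !withinSE IHj; congr (_ || _).
  by apply: eq_existsb => w; rewrite IHj adjE.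
pose c := Ordinal mid_lt; pose c' := Ordinal umid_lt.
have nearhub j : near h.+1 (Spine c) (Hub j).
  rewrite -add1n; apply: within_trans (near_hub (leqnn h) _); last by rewrite subnn.
  by apply: near1; rewrite /= !eqxx.
apply: (@udiam_eqI _ _ _ (fun u => spine_rank (dec u)) (enc (Spine c)) (enc (Spine c'))
  (enc (Spine ord0)) (enc (Spine ord_max))); rewrite ?encK //=.
- rewrite winE; have -> : nat_of_bool (odd D) = c' - c by rewrite /= uphalf_half; lia.
  by apply: near_spine; rewrite /= uphalf_half; lia.
- move=> v; rewrite !winE -(decK v).
  case: (dec v) => [[[w j]|j]|[i|j]].
  (* One edge to the root hub, at most [h] in the tree, one onto the wire. *)
  + left; apply: (@within_mono _ _ (h.+1 + 1)); first by lia.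
    by apply: within_trans (nearhub j) _; apply: near1; rewrite /= eqxx.
  + by left; apply: within_mono (nearhub j); lia.
  + have [ic|ci] := leqP i c; [left|right].
      by apply: within_mono (nearC (near_spine ic)); rewrite /=; lia.
    apply: within_mono (@near_spine c' i _); have := ltn_ord i; move: ci => /=;
      rewrite uphalf_half; lia.
  + by left; apply: within_mono (near1 _); [lia|rewrite /= eqxx].
- by move=> u v; rewrite adjE => /spine_rank_lipschitz.
Qed.

(** Both ends lie in the last column: leftward wires start there, and the target must stay in Bob's
    zone. *)
Definition source : 'I_n := enc (Wire (inr (ord0, false)) ord_max).
Definition target : 'I_n := enc (Wire (inr (ord_max, true)) ord_max).

(* The second disjunct accounts for the dead ends behind Bob's reversed arcs. *)
Definition on_walk x y (u : node) : bool :=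
  match u with
  | Wire (inr (i, p)) _ => p == inner_prefix x y i
  | Wire (inl (i, p, b, q)) c =>
      (p == inner_prefix x y i) && (b == x i)
      || (c == T.*2.+1 :> nat) && (q != p (+) (b && y i))
  | _ => false
  end.

Lemma on_walk_closed x y u v :
  oriented base (enabled x y) u v -> on_walk x y u -> on_walk x y v.
Proof.
rewrite /oriented.
case: u => [[[[[[[i p] b] q]|[i p]] c]|c]|[i|j]] //=;
case: v => [[[[[[[i' p'] b'] q']|[i' p']] c']|c']|[i'|j']] //=; rewrite ?andbF ?orbF ?andbT //.
- by case/andP => /eqP[<- <- <- <-] /eqP c'E /orP[-> //|]; have := ltn_ord c'; lia.
- case/orP => /andP[/and4P[/eqP iE /eqP pE _ /eqP c'E] en].
    case/orP => [/andP[/eqP ip /eqP bx]|/andP[_]]; last by rewrite en.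
    by rewrite pE iE inner_prefixS -ip -bx.
  (* A reversed arc of Alice would leave a wire with [b != x i] in column [0], which is not on the
     walk. *)
  by rewrite (negbTE en) andbF c'E.
- case/orP => /andP[/and4P[/eqP iE /eqP pE /eqP cE /eqP c'E] en].
    by rewrite pE iE en andbT => ->.
  by rewrite cE eqxx en orbT.
- by case/andP => /eqP[<- <-].
Qed.

Lemma gadget_reachable x y : reachable (gadget x y) source target = inner_prefix x y k.
Proof.
rewrite /reachable; apply/idP/idP => [/connectP[p]|].
  have walk0 : on_walk x y (dec source) by rewrite encK /= inner_prefix0.
  elim: p source walk0 => [|v p IHp] u /= walku.
    by move=> _ uE; move: walku; rewrite -uE encK /= eq_sym eqb_id.
  by case/andP=> uv; apply: IHp; apply: on_walk_closed uv walku.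
pose conn u v := connect (gadget x y) (enc u) (enc v).
have step u v : oriented base (enabled x y) u v -> conn u v.
  by move=> uv; apply: connect1; rewrite /gadget /= !encK.
have forth f (c : 'I_T.*2.+2) : conn (Wire (inl f) ord0) (Wire (inl f) c).
  case: c => c; elim: c => [|c IHc] cT.
    by apply: eq_connect0; congr (enc (Wire _ _)); apply: val_inj.
  apply: connect_trans (IHc (ltnW cT)) (step _ _ _).
  by case: f {IHc} => [[[i p] b] q]; rewrite /oriented /= !eqxx.
have back f (c : 'I_T.*2.+2) : conn (Wire (inr f) c) (Wire (inr f) ord0).
  case: c => c; elim: c => [|c IHc] cT.
    by apply: eq_connect0; congr (enc (Wire _ _)); apply: val_inj.
  apply: connect_trans (step _ _ _) (IHc (ltnW cT)).
  by case: f {IHc} => [i p]; rewrite /oriented /= !eqxx.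
have walk i (ik : i < k.+1) :
    conn (Wire (inr (ord0, false)) ord_max)
         (Wire (inr (Ordinal ik, inner_prefix x y i)) ord_max).
  elim: i ik => [|i IHi] ik.
    rewrite inner_prefix0; apply: eq_connect0.
    by congr (enc (Wire (inr (_, _)) _)); apply: val_inj.
  set a := inner_prefix x y i.+1; pose i' : 'I_k := Ordinal (ik : i < k).
  have aE : a = inner_prefix x y i (+) (x i' && y i') by rewrite /a (inner_prefixS x y i').
  (* Back to Alice, who enables [b = x i]; of the two remaining wires Bob enables the one ending in
     the updated bit [a]. *)
  apply: connect_trans (IHi (ltnW ik)) _; apply: connect_trans (back _ _) _.
  apply: connect_trans (step _ (Wire (inl (i', inner_prefix x y i, x i', a)) ord0) _) _.
    by rewrite /oriented /= !eqxx.
  apply: connect_trans (forth _ ord_max) (step _ _ _).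
  by rewrite /oriented /= !eqxx /= aE eqxx.
move=> ip; have := walk k (ltnSn k); rewrite ip.
by congr (connect _ _ (enc (Wire (inr (_, _)) _))); apply: val_inj.
Qed.

End Embedding.
End Gadget.

(** * The bound in the diameter *)

Section SpineOnly.
Variables (n D : nat).
Hypotheses (D_gt1 : 1 < D) (Dn : D < n).
Implicit Types u v : 'I_n.

Definition broom u v : bool :=
  (v == u.+1 :> nat) && (v <= D) || (u == D./2 :> nat) && (D < v).

Definition broom_graph (intact : bool) : rel 'I_n :=
  oriented broom (fun u v => intact || (u != 0 :> nat)).

Definition broom_rank u : nat := if u <= D then u : nat else D./2.

Let o (i : nat) (iD : i <= D) : 'I_n := Ordinal (leq_ltn_trans iD Dn).

Lemma broom_irrefl u : broom u u = false.
Proof. rewrite /broom; lia. Qed.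

Lemma broom_loopless x : loopless (broom_graph x).
Proof. by move=> v; rewrite /broom_graph /oriented broom_irrefl. Qed.

Lemma uadj_broom x u v : uadj (broom_graph x) u v = broom u v || broom v u.
Proof.
by rewrite /uadj /broom_graph oriented_sym; case: eqVneq => // ->; rewrite broom_irrefl.
Qed.

Lemma broom_rank_lipschitz u v : broom u v || broom v u -> broom_rank v <= (broom_rank u).+1.
Proof. by rewrite /broom /broom_rank; case: (leqP u D); case: (leqP v D); lia. Qed.

Lemma broom_udiam x : udiam_eq (broom_graph x) D.
Proof.
have DE := odd_double_half D; set r := uadj (broom_graph x).
have spine i j (iD : i <= D) (jD : j <= D) : i <= j -> within r (j - i) (o iD) (o jD).
  move=> ij; move: (subnK ij); move: (j - i) => d; elim: d j jD {ij} => [|d IHd] j jD jE.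
    have -> : o jD = o iD by apply/val_inj/esym.
    exact: within0.
  have dD : d + i <= D by lia.
  rewrite -addn1; apply: within_trans (IHd _ dD erefl) _.
  by apply: within1; rewrite /r uadj_broom /broom /= jD -jE eqxx.
have mD : D./2 <= D by lia.
have uD : uphalf D <= D by rewrite uphalf_half; lia.
apply: (@udiam_eqI _ _ _ broom_rank (o mD) (o uD) (o (leq0n D)) (o (leqnn D))).
- have -> : nat_of_bool (odd D) = uphalf D - D./2 by rewrite uphalf_half; lia.
  by apply: spine; rewrite uphalf_half; lia.
- move=> v; have [vD|Dv] := leqP v D; last first.
    left; apply: (@within_mono _ _ 1); first by lia.
    by apply: within1; rewrite uadj_broom /broom /= Dv eqxx orbT.
  have -> : v = o vD by apply: val_inj.
  have [vm|mv] := leqP v D./2; [left|right].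
    by apply: (within_mono _ (within_sym (@uadjC _ _) (spine _ _ vD mD vm))); lia.
  have uv : uphalf D <= v by rewrite uphalf_half; lia.
  by apply: (within_mono _ (spine _ _ uD vD uv)); rewrite uphalf_half; lia.
- by move=> u v; rewrite uadj_broom => /broom_rank_lipschitz.
- by [].
- by rewrite /broom_rank /= leqnn.
Qed.

Lemma broom_reachable x : reachable (broom_graph x) (o (leq0n D)) (o (leqnn D)) = x.
Proof.
rewrite /reachable; case: x; last first.
  apply/negbTE/negP => /connectP[[|v p] /=]; first by move=> _ /(congr1 val) /=; lia.
  case/andP; rewrite /broom_graph /oriented /broom /=; lia.
suff walk i (iD : i <= D) : connect (broom_graph true) (o (leq0n D)) (o iD).
  exact: walk.
elim: i iD => [|i IHi] iD.
  by apply: eq_connect0; apply: val_inj.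
apply: connect_trans (IHi (ltnW iD)) (connect1 _).
by rewrite /broom_graph /oriented /broom /= eqxx iD.
Qed.

(** Two events of probability 2/3 intersect, so some coins succeed on both orientations; but if
    [T.+1 < D], cut and paste without crossing edges gives equal outputs. *)
Lemma diameter_bound B m T (Out : eqType) (A : congest_algo n B m Out)
    (ans : rel 'I_n -> 'I_n -> 'I_n -> Out) (dec : Out -> bool) :
  (forall e s t, dec (ans e s t) = reachable e s t) ->
  (forall (e : rel 'I_n) (s t : 'I_n),
     loopless e -> udiam_eq e D -> succeeds_whp A T e s t (ans e s t)) ->
  D <= T.+1.
Proof.
move=> decE succ; rewrite leqNgt; apply/negP => TD.
pose s := o (leq0n D); pose t := o (leqnn D).
pose G x := [set w | @output _ _ _ _ A (state A (broom_graph x) s t w T t)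
                     == ans (broom_graph x) s t].
have Gbig x : 2 * #|{ffun 'I_n -> {ffun 'I_m -> bool}}| <= 3 * #|G x|.
  exact: succ (broom_loopless x) (broom_udiam x).
have Om0 : 0 < #|{ffun 'I_n -> {ffun 'I_m -> bool}}|.
  by apply/card_gt0P; exists [ffun=> [ffun=> false]].
have GU : #|G true :|: G false| <= #|{ffun 'I_n -> {ffun 'I_m -> bool}}|.
  exact: max_card.
have /card_gt0P[w] : 0 < #|G true :&: G false|.
  have := cardsUI (G true) (G false); have := Gbig true; have := Gbig false; lia.
rewrite !inE => /andP[/eqP out1 /eqP out0].
pose e (x : bool) (_ : unit) := broom_graph x.
(* The shift puts both ends of the first arc at position 0 and the target at [D - 1 > T]. *)
pose pos v := (broom_rank v).-1.
pose cross (_ : nat) (_ : 'I_0) := (s, s).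
have rect := @transcript_rectangular n B m 0 T Out A bool unit e s t
  (fun u v => broom u v || broom v u) pos cross w.
have [||||||_] := rect _ _ _ _ _ dec true false tt tt.
- by move=> x [] u v; rewrite uadj_broom.
- move=> x x' [] v; rewrite /pos /broom_rank => pv.
  by congr LocalInput; apply/setP => u; rewrite !inE /e /broom_graph /oriented /broom;
    move: pv; case: (leqP v D) => vD pv; case: x; case: x'; rewrite //=; lia.
- by [].
- by move=> c u v; rewrite /pos => /broom_rank_lipschitz; lia.
- by rewrite /pos /broom_rank /= leqnn; lia.
- by apply/ffunP => -[q []].
by rewrite out1 out0 !decE !broom_reachable.
Qed.

End SpineOnly.

(** * Counting messages and the final bound *)

Lemma card_transcripts T B h :
  #|{ffun 'I_T * bool * 'I_h -> msg B}| <= 2 ^ (B.+1 * (T.*2 * h)).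
Proof.
rewrite card_ffun !card_prod !card_ord card_bool card_option card_tuple card_bool.
rewrite [leqRHS]expnM -muln2; have [->//|exp_gt0] := posnP (T * 2 * h).
(* Silence included, a message takes [2 ^ B + 1 <= 2 ^ B.+1] values. *)
by rewrite leq_exp2r // expnS mul2n -addnn -addn1 leq_add2l expn_gt0.
Qed.

Lemma card_node k T D r : #|{: node k T D r}| =
  (k * 8 + k.+1 * 2) * T.*2.+2 + T.*2.+2 + (D.+1 + r).
Proof. rewrite /node /wire !card_sum !card_prod !card_sum !card_prod !card_ord card_bool; lia. Qed.

(** If the gadget fitted into [n] nodes, success would force [2 ^ c <= 3 * 2 ^ (c - 2)] for
    [c = k./2]. The doubling in [k] makes the number of vectors the square of [2 ^ c]; the summand 2
    gives the factor 4 that beats 3. *)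
Lemma congestion_bound n D B m T h (Out : eqType) (A : congest_algo n B m Out)
    (ans : rel 'I_n -> 'I_n -> 'I_n -> Out) (dec : Out -> bool) :
  (forall e s t, dec (ans e s t) = reachable e s t) ->
  (forall (e : rel 'I_n) (s t : 'I_n),
     loopless e -> udiam_eq e D -> succeeds_whp A T e s t (ans e s t)) ->
  T.*2.+2 <= 2 ^ h -> h + 2 <= D./2 ->
  forall k, k = (B.+1 * (T.*2 * h) + 2).*2 ->
  n < (k * 8 + k.+1 * 2) * T.*2.+2 + T.*2.+2 + D.+1.
Proof.
set c := B.+1 * (T.*2 * h) + 2 => decE succ Th hD k kE.
rewrite ltnNge; apply/negP => used.
pose r := n - ((k * 8 + k.+1 * 2) * T.*2.+2 + T.*2.+2 + D.+1).
have nE : #|{: node k T D r}| = n by rewrite card_node /r addnA subnKC.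
pose ndec (v : 'I_n) : node k T D r := enum_val (cast_ord (esym nE) v).
pose nenc (u : node k T D r) : 'I_n := cast_ord nE (enum_rank u).
have decK : cancel ndec nenc.
  by move=> v; rewrite /ndec /nenc enum_valK cast_ordKV.
have encK : cancel nenc ndec.
  by move=> u; rewrite /ndec /nenc cast_ordK enum_rankK.
pose e := gadget h ndec.
pose s := source nenc; pose t := target nenc.
pose X := {ffun 'I_k -> bool}.
have cardX : #|X| = (2 ^ c) ^ 2.
  by rewrite card_ffun card_ord card_bool kE -expnM muln2.
have : 2 ^ c <= 3 * #|{ffun 'I_T * bool * 'I_h -> msg B}|.
  apply: (@two_thirds_success_bound X X (2 ^ c) (fun x y => inner_prefix x y k)
    _ cardX cardX _ {ffun 'I_n -> {ffun 'I_m -> bool}} _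
    (fun w => transcript T A e s t (@gadget_cross _ _ h _ _ _ nenc) w)
    (fun w x y => dec (@output _ _ _ _ A (state A (e x y) s t w T t)))).
  - by rewrite expn_gt0.
  - exact: inner_product_orthogonal.
  - by apply/card_gt0P; exists [ffun=> [ffun=> false]].
  - move=> w; apply: (@transcript_rectangular _ _ _ _ _ _ _ _ _ _ _ _
      (gadget_adj h ndec) (fun v => pos (ndec v))).
    + by move=> x y; apply: uadj_gadget.
    + by move=> x x' y v; apply: gadget_left_input.
    + by move=> x y y' v; apply: gadget_right_input.
    + by move=> j v u; apply: gadget_crossP.
    + by rewrite encK /=; lia.
  - move=> x y; apply: leq_trans (succ (e x y) s t _ _) _.
    + exact: gadget_loopless.
    + exact: gadget_udiam.
    + rewrite leq_mul2l subset_leq_card //; apply/subsetP => w; rewrite !inE => /eqP ->.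
      by rewrite decE gadget_reachable.
apply/negP; rewrite -ltnNge; apply: leq_ltn_trans (leq_mul (leqnn 3) (card_transcripts _ _ _)) _.
by rewrite /c addnC expnD ltn_pmul2r // expn_gt0.
Qed.

Lemma reachability_round_lower_bound (Out : eqType) (dec : Out -> bool)
    (ans : forall n, rel 'I_n -> 'I_n -> 'I_n -> Out) :
  (forall n (e : rel 'I_n) s t, dec (ans n e s t) = reachable e s t) ->
  round_lower_bound ans.
Proof.
(* [N = 2] keeps the logarithms positive and [c0 = 6] yields [l + 2 <= D./2]. The final estimates
   bound the gadget by [4 * (122 * 4 + 4 + 3) = 1980] times [b * (T * lam) ^ 2], which
   [45 ^ 2 = 2025] exceeds. *)
move=> decE b b0; exists (45 * b), 2, 6; split; first by rewrite muln_gt0.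
move=> n n2 D /andP[lD Dn] m T A succ.
set l := up_log 2 n in A succ lD; set lam := trunc_log 2 n.
have l0 : 0 < l by rewrite up_log_gt0.
have lam0 : 0 < lam by rewrite trunc_log_gt0.
have l_lam : l <= lam.*2.
  have : l <= lam.+1 by rewrite up_log_min // ltnW // trunc_log_ltn.
  lia.
have DT : D <= T.+1 by apply: (diameter_bound _ _ (decE n) succ); lia.
split; first by nia.
have n_l : n <= 2 ^ l by rewrite up_logP.
set Q := 45 * b * T * lam.
(* Otherwise the gadget with [h = l] would have at most [Q ^ 2 < n] nodes, against
   [congestion_bound]. *)
have [//|Qn] := leqP n (Q ^ 2).
have T0 : 0 < T by lia.
have QT : 45 * T <= Q.
  by rewrite /Q -mulnA -mulnA [b * _]mulnCA mulnA leq_pmulr // muln_gt0 b0.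
have TQ : T.*2.+2 <= Q ^ 2 by nia.
have := congestion_bound (decE n) succ (leq_trans (leq_trans TQ (ltnW Qn)) n_l).
have hD : l + 2 <= D./2 by lia.
move=> /(_ hD _ erefl); set k := (_ + 2).*2 => used.
rewrite -(ltnn n) (leq_trans used) // (leq_trans _ (ltnW Qn)) //.
set P := b * T * l ^ 2.
have P0 : 0 < P by rewrite !muln_gt0 b0 T0 l0.
have kP : k <= 12 * P.
  have Bl : (b * l).+1 <= 2 * (b * l) by nia.
  have : (b * l).+1 * (T.*2 * l) <= 4 * P.
    apply: leq_trans (leq_mul Bl (leqnn _)) _.
    by have -> : 2 * (b * l) * (T.*2 * l) = 4 * P by rewrite /P -muln2; ring.
  by rewrite /k; lia.
have PT : P * T <= 4 * b * (T * lam) ^ 2.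
  have -> : P * T = b * (T * l) ^ 2 by rewrite /P; ring.
  have -> : 4 * b * (T * lam) ^ 2 = b * (T * lam.*2) ^ 2 by rewrite -muln2; ring.
  by rewrite leq_mul2l leq_exp2r // leq_mul2l l_lam !orbT.
have QE : Q ^ 2 = 2025 * b * (b * (T * lam) ^ 2) by rewrite /Q; ring.
have wires : (k * 8 + k.+1 * 2) * T.*2.+2 <= 122 * P * (4 * T) by apply: leq_mul; lia.
have PT1 : T <= P * T by rewrite leq_pmull.
have bb : b * (T * lam) ^ 2 <= b * (b * (T * lam) ^ 2) by rewrite leq_pmull.
rewrite QE; nia.
Qed.

Theorem theorem4 :
  round_lower_bound (fun n (e : rel 'I_n) s t => reachable e s t) /\
  round_lower_bound (fun n (e : rel 'I_n) s t => ddist e s t).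
Proof.
split; first exact: (reachability_round_lower_bound (dec := id)).
apply: (reachability_round_lower_bound (dec := fun d => d != None)) => n e s t.
exact: ddist_reachable.
Qed.
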